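(* Let $n,m\ge1$. The maps $\Psi_1$ and $\Psi_2$ preserve the Loewner order. More precisely: (1) if $A,B\in\mathscr{P}_n(\mathbb{C})$ satisfy $A\preceq B$, then $\Psi_1(A)\preceq\Psi_1(B)$; (2) if $C,D\in\mathscr{P}_m(\mathbb{H})$ satisfy $C\preceq D$, then $\Psi_2(C)\preceq\Psi_2(D)$.
   Context: For $\mathbb{D}\in\{\mathbb{R},\mathbb{C},\mathbb{H}\}$, $A^*$ is the conjugate transpose of $A\in\mathrm{Mat}_n(\mathbb{D})$. $\mathscr{P}_n(\mathbb{D})$ (resp. $\mathscr{P}^0_n(\mathbb{D})$) is the set of $A\in\mathrm{Mat}_n(\mathbb{D})$ with $A=A^*$ and $x^*Ax>0$ (resp. $x^*Ax\ge0$) for all nonzero $x\in\mathbb{D}^n$. The Loewner order on $\mathscr{P}_n(\mathbb{D})$ is $A\preceq B$ iff $B-A\in\mathscr{P}^0_n(\mathbb{D})$. The maps $\Psi_1:\mathrm{Mat}_n(\mathbb{C})\to\mathrm{Mat}_{2n}(\mathbb{R})$ and $\Psi_2:\mathrm{Mat}_m(\mathbb{H})\to\mathrm{Mat}_{2m}(\mathbb{C})$ are $\Psi_1(A+iB)=\begin{pmatrix}A&B\\-B&A\end{pmatrix}$ ($A,B\in\mathrm{Mat}_n(\mathbb{R})$) and $\Psi_2(Z_1+Z_2j)=\begin{pmatrix}Z_1&Z_2\\-\overline{Z_2}&\overline{Z_1}\end{pmatrix}$ ($Z_1,Z_2\in\mathrm{Mat}_m(\mathbb{C})$, using $\mathbb{H}=\mathbb{C}\oplus\mathbb{C}j$).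 They map $\mathscr{P}_n(\mathbb{C})$ into $\mathscr{P}_{2n}(\mathbb{R})$ and $\mathscr{P}_m(\mathbb{H})$ into $\mathscr{P}_{2m}(\mathbb{C})$. *)

(* Defs.v *)
From HB Require Import structures.
From mathcomp Require Import all_boot all_order all_algebra.
From mathcomp Require Import complex reals ring.

Set Implicit Arguments.
Unset Strict Implicit.
Unset Printing Implicit Defensive.

Import Order.TTheory GRing.Theory Num.Theory.
Local Open Scope ring_scope.
Local Open Scope complex_scope.

(* Quaternions as H = C (+) C j: [Quat z w] stands for z + w j. *)
Record quat (R : Type) := Quat { qfst : R[i]; qsnd : R[i] }.

Section QuatRing.
Variable R : realType.
Implicit Types p q r : quat R.

Definition quat_pair q := (qfst q, qsnd q).
Definition pair_quat (u : R[i] * R[i]) : quat R := Quat u.1 u.2.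
Lemma quat_pairK : cancel quat_pair pair_quat. Proof. by case. Qed.

HB.instance Definition _ := Choice.copy (quat R) (can_type quat_pairK).

Definition qzero : quat R := Quat 0 0.
Definition qone : quat R := Quat 1 0.
Definition qopp q : quat R := Quat (- qfst q) (- qsnd q).
Definition qadd p q : quat R := Quat (qfst p + qfst q) (qsnd p + qsnd q).
(* Determined by j ^ 2 = -1 and j z = (conjc z) j for complex z. *)
Definition qmul p q : quat R :=
  Quat (qfst p * qfst q - qsnd p * conjc (qsnd q))
       (qfst p * qsnd q + qsnd p * conjc (qfst q)).

Lemma qaddA : associative qadd.
Proof. by move=> p q r; rewrite /qadd /= !addrA. Qed.
Lemma qaddC : commutative qadd.
Proof. by move=> p q; rewrite /qadd addrC [X in Quat _ X]addrC. Qed.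
Lemma qadd0 : left_id qzero qadd.
Proof. by case=> z w; rewrite /qadd /= !add0r. Qed.
Lemma qaddN : left_inverse qzero qopp qadd.
Proof. by case=> z w; rewrite /qadd /= !addNr. Qed.

HB.instance Definition _ :=
  GRing.isZmodule.Build (quat R) qaddA qaddC qadd0 qaddN.

Lemma qmulA : associative qmul.
Proof.
case=> a b [c d] [e f]; rewrite /qmul /= !(rmorphB, rmorphD, rmorphM) /=.
by rewrite !conjcK; congr Quat; ring.
Qed.

Lemma qmul1l : left_id qone qmul.
Proof. by case=> z w; rewrite /qmul /= !mul1r !mul0r subr0 addr0. Qed.
Lemma qmul1r : right_id qone qmul.
Proof.
case=> z w.
change (Quat (z * 1 - w * conjc 0) (z * 0 + w * conjc 1) = Quat z w).
by rewrite conjc0 conjc1 !mulr1 !mulr0 subr0 add0r.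
Qed.
Lemma qmulDl : left_distributive qmul qadd.
Proof.
case=> a b [c d] [e f]; rewrite /qmul /qadd /= !mulrDl opprD.
by congr Quat; rewrite addrACA.
Qed.
Lemma qmulDr : right_distributive qmul qadd.
Proof.
case=> a b [c d] [e f]; rewrite /qmul /qadd /= !rmorphD !mulrDr opprD.
by congr Quat; rewrite addrACA.
Qed.
Lemma qone_neq0 : qone != qzero.
Proof. by apply/eqP => -[/eqP]; rewrite oner_eq0. Qed.

HB.instance Definition _ :=
  GRing.Zmodule_isNzRing.Build (quat R)
    qmulA qmul1l qmul1r qmulDl qmulDr qone_neq0.

Definition qconj q : quat R := Quat (conjc (qfst q)) (- qsnd q).

(* In R[i], [0 < z] and [0 <= z] entail that z is real, hence so here. *)
Definition qpos : pred (quat R) := [pred q | (0 < qfst q) && (qsnd q == 0)].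
Definition qnneg : pred (quat R) := [pred q | (0 <= qfst q) && (qsnd q == 0)].

Definition quatC (z : R[i]) : quat R := Quat z 0.
Definition qj : quat R := Quat 0 1.

Lemma quatE q : q = quatC (qfst q) + quatC (qsnd q) * qj.
Proof.
case: q => z w.
change (Quat z w = Quat (z + (w * 0 - 0 * conjc 1)) (0 + (w * 1 + 0 * conjc 0))).
by rewrite mulr0 !mul0r mulr1 subr0 !addr0 add0r.
Qed.
Lemma qj2 : qj * qj = -1.
Proof.
change (Quat (0 * 0 - 1 * conjc 1) (0 * 1 + 1 * conjc 0) = Quat (- 1) (- 0) :> quat R).
by rewrite conjc0 conjc1 !mul0r mulr0 mulr1 sub0r addr0 oppr0.
Qed.
Lemma qjC z : qj * quatC z = quatC (conjc z) * qj.
Proof.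
change (Quat (0 * z - 1 * conjc 0) (0 * 0 + 1 * conjc z) =
        Quat (conjc z * 0 - 0 * conjc 1) (conjc z * 1 + 0 * conjc 0)).
by rewrite conjc0 !mulr0 !mul0r mulr1 mul1r !add0r addr0.
Qed.

End QuatRing.

(* [conj], [pos] and [nneg] are the conjugation of D and its predicates
   "is a positive real" and "is a nonnegative real". *)
Section Loewner.
Variables (D : nzRingType) (conj : D -> D) (pos nneg : pred D).

Definition adjmx m n (A : 'M[D]_(m, n)) : 'M[D]_(n, m) := (map_mx conj A)^T.

Definition posdefmx n (A : 'M[D]_n) : Prop :=
  A = adjmx A /\
  forall x : 'cV[D]_n, x != 0 -> pos ((adjmx x *m A *m x) 0 0).

Definition possemidefmx n (A : 'M[D]_n) : Prop :=
  A = adjmx A /\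
  forall x : 'cV[D]_n, x != 0 -> nneg ((adjmx x *m A *m x) 0 0).

(* A relation on the set of positive definite matrices: both sides are
   required to belong to that set. *)
Definition loewner n (A B : 'M[D]_n) : Prop :=
  [/\ posdefmx A, posdefmx B & possemidefmx (B - A)].

End Loewner.

Section Instances.
Variable R : realType.

Definition posdefR n (A : 'M[R]_n) : Prop :=
  posdefmx id (fun a => 0 < a) A.
Definition posdefC n (A : 'M[R[i]]_n) : Prop :=
  posdefmx conjc (fun z => 0 < z) A.
Definition posdefH n (A : 'M[quat R]_n) : Prop :=
  posdefmx (@qconj R) (@qpos R) A.

Definition loewnerR n (A B : 'M[R]_n) : Prop :=
  loewner id (fun a => 0 < a) (fun a => 0 <= a) A B.
Definition loewnerC n (A B : 'M[R[i]]_n) : Prop :=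
  loewner conjc (fun z => 0 < z) (fun z => 0 <= z) A B.
Definition loewnerH n (A B : 'M[quat R]_n) : Prop :=
  loewner (@qconj R) (@qpos R) (@qnneg R) A B.

Definition Psi1 n (A : 'M[R[i]]_n) : 'M[R]_(n + n) :=
  block_mx (map_mx (@complex.Re R) A) (map_mx (@complex.Im R) A)
           (- map_mx (@complex.Im R) A) (map_mx (@complex.Re R) A).

Definition Psi2 m (A : 'M[quat R]_m) : 'M[R[i]]_(m + m) :=
  let Z1 := map_mx (@qfst R) A in
  let Z2 := map_mx (@qsnd R) A in
  block_mx Z1 Z2 (- map_mx conjc Z2) (map_mx conjc Z1).

End Instances.

(* Main.v *)
Require Import Defs.
From HB Require Import structures.
From mathcomp Require Import all_boot all_order all_algebra.
From mathcomp Require Import complex reals.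

(** Both [C] over [R] and [H] over [C] are Cayley-Dickson doublings: an element
    of [D] is a pair [(f a, g a)] of elements of a smaller ring [E] carrying an
    involution [h], with
      [f (a b) = f a f b - g a h (g b)],  [g (a b) = f a g b + g a h (f b)],
    and conjugation [(f a, g a) |-> (h (f a), - g a)]; for [C] over [R] the
    involution is the identity.  The theorem holds for any such doubling
    in which [f] preserves positivity.

    Extend [Psi] to rectangular matrices by the same block formula.  It is then
    additive, multiplicative ([Psi_mul]) and compatible with adjoints
    ([Psi_adj]).  Moreover every column [x] over [E] of height [n + n] is the
    first column of [Psi z] for a column [z] over [D] of height [n]
    ([Psi_col_surj]).  Therefore
      [x^* Psi(A) x = (Psi(z)^* Psi(A) Psi(z))_00 = Psi(z^* A z)_00
                    = f (z^* A z)]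
    ([Psi_form]): the form of [Psi A] takes only values [f q], where [q] is a
    value of the form of [A].  As [f] sends positive (nonnegative) elements of
    [D] to positive (nonnegative) elements of [E], [Psi] preserves positive
    definiteness and semidefiniteness, and by additivity the Loewner order. *)

Set Implicit Arguments.
Unset Strict Implicit.
Unset Printing Implicit Defensive.

Import GRing.Theory Num.Theory.
Local Open Scope ring_scope.

Section CayleyDickson.
Variables (D E : nzRingType) (conj : D -> D) (h : {rmorphism E -> E}).
Variables f g : {additive D -> E}.

Record doubling : Prop := Doubling {
  doubling_invol : involutive h;
  doubling_fM : forall a b, f (a * b) = f a * f b - g a * h (g b);
  doubling_gM : forall a b, g (a * b) = f a * g b + g a * h (f b);
  doubling_fconj : forall a, f (conj a) = h (f a);
  doubling_gconj : forall a, g (conj a) = - g a;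
  doubling_surj : forall u v, exists a, f a = u /\ g a = v
}.

Definition Psi m n (A : 'M[D]_(m, n)) : 'M[E]_(m + m, n + n) :=
  block_mx (map_mx f A) (map_mx g A)
           (- map_mx h (map_mx g A)) (map_mx h (map_mx f A)).

Hypothesis dbl : doubling.

Lemma PsiB m n (A B : 'M[D]_(m, n)) : Psi (A - B) = Psi A - Psi B.
Proof. by rewrite /Psi opp_block_mx add_block_mx !map_mxB opprD. Qed.

Lemma Psi0 m n : Psi (0 : 'M[D]_(m, n)) = 0.
Proof. by rewrite -[X in Psi X](subrr 0) PsiB subrr. Qed.

Lemma map_mx_hK m n (A : 'M[E]_(m, n)) : map_mx h (map_mx h A) = A.
Proof. by apply/matrixP=> i j; rewrite !mxE (doubling_invol dbl). Qed.

Lemma map_f_mul m n p (A : 'M[D]_(m, n)) (B : 'M[D]_(n, p)) :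
  map_mx f (A *m B)
  = map_mx f A *m map_mx f B - map_mx g A *m map_mx h (map_mx g B).
Proof.
apply/matrixP=> i k; rewrite !mxE raddf_sum /= -sumrB.
by apply: eq_bigr => j _; rewrite !mxE (doubling_fM dbl).
Qed.

Lemma map_g_mul m n p (A : 'M[D]_(m, n)) (B : 'M[D]_(n, p)) :
  map_mx g (A *m B)
  = map_mx f A *m map_mx g B + map_mx g A *m map_mx h (map_mx f B).
Proof.
apply/matrixP=> i k; rewrite !mxE raddf_sum /= -big_split.
by apply: eq_bigr => j _; rewrite !mxE (doubling_gM dbl).
Qed.

Lemma Psi_mul m n p (A : 'M[D]_(m, n)) (B : 'M[D]_(n, p)) :
  Psi (A *m B) = Psi A *m Psi B.
Proof.
rewrite /Psi mulmx_block map_f_mul map_g_mul !(map_mxB, map_mxD) !map_mxM /=.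
rewrite !map_mx_hK !mulmxN !mulNmx opprD; congr block_mx; first by rewrite addrC.
by rewrite addrC.
Qed.

Lemma Psi_adj m n (A : 'M[D]_(m, n)) : Psi (adjmx conj A) = adjmx h (Psi A).
Proof.
rewrite /Psi /adjmx map_block_mx tr_block_mx.
congr block_mx; apply/matrixP=> i j; rewrite !mxE.
- by rewrite (doubling_fconj dbl).
- by rewrite (doubling_gconj dbl) rmorphN (doubling_invol dbl).
- by rewrite (doubling_gconj dbl) rmorphN opprK.
- by rewrite (doubling_fconj dbl).
Qed.

(** The first column of [Psi z] stacks [f z] on [- h (g z)], and any pair of
    columns has this form because [h] is bijective and [(f, g)] is onto. *)
Lemma Psi_col_surj n (x : 'cV[E]_(n + n)) :
  exists z : 'cV[D]_n, lsubmx (Psi z) = x.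
Proof.
have pick i : exists a, (f a == usubmx x i 0) && (g a == - h (dsubmx x i 0)).
  have [a [fa ga]] := doubling_surj dbl (usubmx x i 0) (- h (dsubmx x i 0)).
  by exists a; rewrite fa ga !eqxx.
exists (\col_i xchoose (pick i)).
rewrite /Psi block_mxEh row_mxKl -[RHS]vsubmxK.
congr col_mx; apply/matrixP=> i j; rewrite ord1.
  by rewrite 2!mxE; have /andP[/eqP-> _] := xchooseP (pick i).
rewrite 4!mxE; have /andP[_ /eqP->] := xchooseP (pick i).
by rewrite rmorphN (doubling_invol dbl) opprK.
Qed.

Lemma Psi_form n (A : 'M[D]_n) (x : 'cV[E]_(n + n)) : x != 0 ->
  exists2 z : 'cV[D]_n, z != 0 &
    (adjmx h x *m Psi A *m x) 0 0 = f ((adjmx conj z *m A *m z) 0 0).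
Proof.
have [z <-] := Psi_col_surj x => z_neq0; exists z.
  apply: contraNneq z_neq0 => ->; apply/eqP/matrixP=> i j.
  by rewrite Psi0 !mxE.
have -> : f ((adjmx conj z *m A *m z) 0 0)
        = Psi (adjmx conj z *m A *m z) (lshift 1 0) (lshift 1 0).
  by rewrite /Psi block_mxEul [RHS]mxE.
rewrite !Psi_mul Psi_adj !mxE.
apply: eq_bigr => k _; rewrite !mxE; congr (_ * _).
by apply: eq_bigr => l _; rewrite !mxE.
Qed.

(** [posdefmx] and [possemidefmx] are the same predicate with a different sign
    condition, so this covers both. *)
Lemma Psi_posdef (pos : pred D) (posE : pred E) n (A : 'M[D]_n) :
  (forall a, pos a -> posE (f a)) ->
  posdefmx conj pos A -> posdefmx h posE (Psi A).
Proof.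
move=> f_pos [A_herm A_pos]; split; first by rewrite -Psi_adj -A_herm.
by move=> x /(Psi_form A)[z /A_pos z_pos ->]; apply: f_pos.
Qed.

Lemma Psi_loewner (pos nneg : pred D) (posE nnegE : pred E) n (A B : 'M[D]_n) :
  (forall a, pos a -> posE (f a)) -> (forall a, nneg a -> nnegE (f a)) ->
  loewner conj pos nneg A B -> loewner h posE nnegE (Psi A) (Psi B).
Proof.
move=> f_pos f_nneg [posA posB leAB].
split; [exact: Psi_posdef posA | exact: Psi_posdef posB |].
by rewrite -PsiB; apply: Psi_posdef leAB.
Qed.

End CayleyDickson.

Section Instances.
Variable R : realType.

Lemma qfst_is_zmod_morphism : zmod_morphism (@qfst R).
Proof. by []. Qed.
HB.instance Definition _ :=
  GRing.isZmodMorphism.Build (quat R) R[i]%C (@qfst R) qfst_is_zmod_morphism.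

Lemma qsnd_is_zmod_morphism : zmod_morphism (@qsnd R).
Proof. by []. Qed.
HB.instance Definition _ :=
  GRing.isZmodMorphism.Build (quat R) R[i]%C (@qsnd R) qsnd_is_zmod_morphism.

Lemma doubling_complex :
  doubling (@conjc R) idfun (@complex.Re R) (@complex.Im R).
Proof.
split=> [|[a b] [c d]|[a b] [c d]|[a b]|[a b]|u v] //.
by exists (Complex u v).
Qed.

Lemma doubling_quat : doubling (@qconj R) (@conjc R) (@qfst R) (@qsnd R).
Proof. by split=> // [|u v]; [apply: conjcK | exists (Quat u v)]. Qed.

Lemma Psi1E n (A : 'M[R[i]%C]_n) :
  Psi1 A = Psi idfun (@complex.Re R) (@complex.Im R) A.
Proof. by rewrite /Psi !map_mx_id. Qed.

End Instances.

Theorem lemma3p12 (R : realType) (n m : nat) (hn : (1 <= n)%N) (hm : (1 <= m)%N) :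
  (forall A B : 'M[complex R]_n,
      posdefC A -> posdefC B -> loewnerC A B -> loewnerR (Psi1 A) (Psi1 B))
  /\
  (forall C D : 'M[quat R]_m,
      posdefH C -> posdefH D -> loewnerH C D -> loewnerC (Psi2 C) (Psi2 D)).
Proof.
split=> [A B _ _ leAB | C D _ _ leCD].
  rewrite !Psi1E; apply: (Psi_loewner (doubling_complex R) _ _ leAB).
  - by move=> [a b]; rewrite ltcE => /andP[].
  - by move=> [a b]; rewrite lecE => /andP[].
by apply: (Psi_loewner (doubling_quat R) _ _ leCD) => q /andP[].
Qed.
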